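(* Fix $\xi>0$ and choose $0<\ell<\frac{1}{2\xi}$. Let $$\mathcal{T}=[0,\ell]\cup\left[\frac1\xi,\frac1\xi+\ell\right],$$ which has measure $|\mathcal{T}|=2\ell$ and essential diameter $\operatorname{diam}_{\mathrm{ess}}(\mathcal{T})=\frac1\xi+\ell$. Then $$|\widehat{\mathbf{1}_{\mathcal{T}}}(\xi)|=\frac{2\sin(\pi\xi\ell)}{\pi\xi}>\frac{\sin(2\pi\xi\ell)}{\pi\xi}=\widehat{\mathbf{1}_{[-\ell,\ell]}}(\xi).$$
   Context: The Fourier transform is $\widehat f(\xi)=\int_{\mathbb{R}}f(t)e^{-2\pi i\xi t}\,dt$, and $\mathbf{1}_{\mathcal{T}}$ is the indicator function of $\mathcal{T}$. $|\mathcal{T}|$ denotes Lebesgue measure. The essential diameter is $\operatorname{diam}_{\mathrm{ess}}(\mathcal{T})=\operatorname{ess\,sup}\mathcal{T}-\operatorname{ess\,inf}\mathcal{T}$, where $\operatorname{ess\,sup}\mathcal{T}$ and $\operatorname{ess\,inf}\mathcal{T}$ are the essential supremum and infimum of the identity function on $\mathcal{T}$. *)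

(* Defs.v *)
From HB Require Import structures.
From mathcomp Require Import all_boot all_order all_algebra.
From mathcomp Require Import all_classical all_reals all_analysis.
From mathcomp Require Import ess_sup_inf complex.

Set Implicit Arguments.
Unset Strict Implicit.
Unset Printing Implicit Defensive.

Import Order.TTheory GRing.Theory Num.Theory.
Import numFieldNormedType.Exports.

Local Open Scope classical_set_scope.
Local Open Scope ring_scope.
Local Open Scope complex_scope.

Definition expC (R : realType) (z : R[i]) : R[i] :=
  (expR (complex.Re z))%:C * (cos (complex.Im z) +i* sin (complex.Im z)).

(* Meaningful when the real and imaginary parts of g are Lebesgue integrable
   (the library's Rintegral is a total function). *)
Definition Cintegral (R : realType) (g : R -> R[i]) : R[i] :=
  (\int[@lebesgue_measure R]_t complex.Re (g t))
    +i* (\int[@lebesgue_measure R]_t complex.Im (g t)).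

Definition fourier (R : realType) (f : R -> R[i]) (xi : R) : R[i] :=
  Cintegral (fun t => f t * expC ((- (2 * pi * xi * t)) *i)).

(* The essential supremum and infimum over D are those with respect to Lebesgue
   measure restricted to D, so that only null subsets of D are neglected. *)
Definition ess_diam (R : realType) (D : set R) (mD : measurable D) : \bar R :=
  (ess_sup (mrestr (@lebesgue_measure R) mD) EFin
   - ess_inf (mrestr (@lebesgue_measure R) mD) EFin)%E.

Definition twin_itv (R : realType) (xi l : R) : set R :=
  `[0, l] `|` `[1 / xi, 1 / xi + l].

Lemma measurable_twin_itv (R : realType) (xi l : R) :
  measurable (twin_itv xi l).
Proof. by apply: measurableU; exact: measurable_itv. Qed.

(* Main.v *)
Require Import Defs.
From HB Require Import structures.
From mathcomp Require Import all_boot all_order all_algebra.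
From mathcomp Require Import all_classical all_reals all_analysis.
From mathcomp Require Import ess_sup_inf complex.
From mathcomp Require Import measurable_realfun ring lra.

(** The exponential [t |-> exp (- 2 i pi xi t)] has period [1 / xi], so the two
    halves of [twin_itv xi l], which are translates of each other by one
    period, have the same Fourier coefficient at [xi]
    ([fourier_indic_itv_shift]).  They add up without any cancellation
    ([fourier_indicU]), and each has modulus [sin c / (pi xi)] with
    [c = pi xi l] ([norm_fourier_indic_itv]); hence the value
    [2 sin c / (pi xi)].

    In the single interval [`[- l, l]], on the other hand, the phases vary over
    twice the range, and its coefficient is
    [sin (2 c) / (pi xi) = 2 sin c cos c / (pi xi)].  The factor [cos c] is the
    loss: the condition [l < 1 / (2 xi)] says that [0 < c < pi / 2], whence
    [sin c > 0], which makes [cos c < 1] and the inequality strict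
    ([sin2x_lt]).

    The same condition makes the two halves disjoint, which gives the measure.
    For the essential diameter, the essential supremum of the identity on a set
    is its upper bound [b] as soon as the set contains an open interval ending
    at [b], because no left neighbourhood of [b] is then negligible; the
    essential infimum is symmetric ([ess_sup_mrestr], [ess_inf_mrestr]). *)

Set Implicit Arguments.
Unset Strict Implicit.
Unset Printing Implicit Defensive.

Import Order.TTheory GRing.Theory Num.Theory.
Import numFieldNormedType.Exports.

Local Open Scope classical_set_scope.
Local Open Scope ring_scope.
Local Open Scope complex_scope.

(** * Essential bounds of a set containing an interval *)

Section essential_bounds.
Variable R : realType.
Local Notation mu := (@lebesgue_measure R).

(** A nonempty open interval has positive measure, so a property that holds
    almost everywhere on a set containing it cannot fail all along it. *)
Lemma ae_mrestr_itv (D : set R) (mD : measurable D) (a b : R) (P : R -> Prop) :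
  a < b -> `]a, b[ `<=` D -> (\forall x \ae mrestr mu mD, P x) ->
  exists2 x, a < x < b & P x.
Proof.
move=> ab abD [N [mN N0 PN]]; apply: contrapT => noP.
have abN : `]a, b[ `<=` N `&` D.
  move=> x xab; split; last exact: (abD x xab).
  by apply: PN => Px; apply: noP; exists x; rewrite // -in_itv.
have : (mu `]a, b[ <= mu (N `&` D))%E.
  apply: le_measure => //; rewrite inE; first exact: measurable_itv.
  exact: measurableI.
move: N0; rewrite /mrestr/= => ->.
by rewrite lebesgue_measure_itv/= lte_fin ab -EFinB lee_fin subr_le0 leNgt ab.
Qed.

Lemma ess_sup_mrestr (D : set R) (mD : measurable D) (a b : R) :
  a < b -> `]a, b[ `<=` D -> D `<=` `]-oo, b] ->
  ess_sup (mrestr mu mD) EFin = b%:E.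
Proof.
move=> ab abD Db; apply/eqP; rewrite eq_le; apply/andP; split.
  apply/ess_supP; exists `]b, +oo[%classic; split => //.
  - rewrite /= /mrestr (_ : _ `&` _ = set0) ?measure0//.
    apply/seteqP; split => // x [] /= + /Db; rewrite /= !in_itv/= andbT.
    by move=> bx; rewrite leNgt bx.
  - by move=> x /= /negP; rewrite lee_fin -ltNge in_itv/= andbT.
rewrite leNgt; apply/negP => sb.
(* The interval ]c, b[ lies in D and strictly above the essential supremum. *)
have [c [ac cb sc]] : exists c, [/\ a <= c, c < b &
    (ess_sup (mrestr mu mD) EFin <= c%:E)%E].
  move: sb; case: ess_sup => [s||] //= sb; last by exists a; rewrite leNye.
  exists (Num.max a s); rewrite le_max lexx gt_max ab lee_fin le_max lexx orbT.
  by rewrite lte_fin in sb.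
have [x|x /andP[cx _]] := ae_mrestr_itv cb _ (ess_sup_ge (mrestr mu mD) EFin).
  rewrite /= in_itv/= => /andP[cx xb].
  by apply: abD; rewrite /= in_itv/= xb (le_lt_trans ac).
by move/le_trans => /(_ _ sc); rewrite lee_fin leNgt cx.
Qed.

Lemma ess_inf_mrestr (D : set R) (mD : measurable D) (a b : R) :
  a < b -> `]a, b[ `<=` D -> D `<=` `[a, +oo[ ->
  ess_inf (mrestr mu mD) EFin = a%:E.
Proof.
move=> ab abD Da; apply/eqP; rewrite eq_le; apply/andP; split; last first.
  apply/ess_infP; exists `]-oo, a[%classic; split => //.
  - rewrite /= /mrestr (_ : _ `&` _ = set0) ?measure0//.
    apply/seteqP; split => // x [] /= + /Da; rewrite /= !in_itv/= andbT.
    by move=> xa; rewrite leNgt xa.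
  - by move=> x /= /negP; rewrite lee_fin -ltNge in_itv/=.
rewrite leNgt; apply/negP => sa.
(* The interval ]a, c[ lies in D and strictly below the essential infimum. *)
have [c [ac cb sc]] : exists c, [/\ a < c, c <= b &
    (c%:E <= ess_inf (mrestr mu mD) EFin)%E].
  move: sa; case: ess_inf => [s||] //= sa; last by exists b; rewrite leey.
  exists (Num.min s b); rewrite ge_min lexx lt_min ab lee_fin ge_min lexx orbT.
  by rewrite lte_fin in sa; rewrite sa.
have [x|x /andP[_ xc]] := ae_mrestr_itv ac _ (ess_inf_le (mrestr mu mD) EFin).
  rewrite /= in_itv/= => /andP[ax xc].
  by apply: abD; rewrite /= in_itv/= ax (lt_le_trans xc).
by move/(le_trans sc); rewrite lee_fin leNgt xc.
Qed.

End essential_bounds.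

(** * Fourier coefficients of indicator functions *)

Section fourier_indicator.
Variable R : realType.
Local Notation mu := (@lebesgue_measure R).

Lemma Rintegral_FTC2 (f F : R -> R) (a b : R) : a < b -> continuous f ->
  (forall x : R, is_derive x 1 F (f x)) ->
  \int[mu]_(x in `[a, b]) f x = F b - F a.
Proof.
move=> ab cf dF.
have cF : continuous F.
  move=> x; apply/differentiable_continuous/derivable1_diffP.
  exact: ex_derive.
rewrite /Rintegral (continuous_FTC2 (F := F)) //.
- exact: continuous_subspaceT.
- split => [x _||]; first exact: ex_derive.
  + by apply: cvg_at_right_filter; exact: cF.
  + by apply: cvg_at_left_filter; exact: cF.
- by move=> x _; rewrite derive1E; apply: derive_val.
Qed.

Lemma continuous_cosM (k : R) : continuous (fun t : R => cos (k * t)).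
Proof.
move=> x; apply: continuous_comp; first exact: mulrl_continuous.
exact: continuous_cos.
Qed.

Lemma continuous_sinM (k : R) : continuous (fun t : R => sin (k * t)).
Proof.
move=> x; apply: continuous_comp; first exact: mulrl_continuous.
exact: continuous_sin.
Qed.

Lemma Rintegral_cosM (k a b : R) : k != 0 -> a < b ->
  \int[mu]_(t in `[a, b]) cos (k * t) = (sin (k * b) - sin (k * a)) / k.
Proof.
move=> k0 ab.
have dF (t : R) : is_derive t 1 (fun t => k^-1 * sin (k * t)) (cos (k * t)).
  by apply: is_derive_eq; rewrite !scaler1 /GRing.scale/=; field.
by rewrite (Rintegral_FTC2 ab (@continuous_cosM k) dF) -mulrBr mulrC.
Qed.

Lemma Rintegral_sinM (k a b : R) : k != 0 -> a < b ->
  \int[mu]_(t in `[a, b]) sin (k * t) = (cos (k * a) - cos (k * b)) / k.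
Proof.
move=> k0 ab.
have dF (t : R) : is_derive t 1 (fun t => - k^-1 * cos (k * t)) (sin (k * t)).
  by apply: is_derive_eq; rewrite !scaler1 /GRing.scale/=; field.
rewrite (Rintegral_FTC2 ab (@continuous_sinM k) dF).
by rewrite -mulrBr mulNr mulrC -mulNr opprB.
Qed.

(** Absorbing the minus sign of the exponent into the frequency
    [k = - 2 pi xi] reduces both components to integrals of [cos (k t)] and
    [sin (k t)]. *)
Lemma fourier_indic (A : set R) (xi : R) :
  fourier (\1_A) xi = (\int[mu]_(t in A) cos (- (2 * pi * xi) * t))
    +i* (\int[mu]_(t in A) sin (- (2 * pi * xi) * t)).
Proof.
rewrite /fourier /Cintegral; congr (_ +i* _); rewrite [RHS]Rintegral_mkcond;
  congr Rintegral; apply/funext => t; rewrite patchE /indic /expC /=;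
  case: (t \in A); rewrite ?mul0r ?mul1r//= expR0; by rewrite mulNr; ring.
Qed.

(** Compactness makes the continuous integrands integrable on [A] and [B]. *)
Lemma fourier_indicU (A B : set R) (xi : R) : compact A -> compact B ->
  [disjoint A & B] ->
  fourier (\1_(A `|` B)) xi = fourier (\1_A) xi + fourier (\1_B) xi.
Proof.
move=> cA cB AB; rewrite !fourier_indic; apply/eqP; rewrite eq_complex/=.
have intU (f : R -> R) : continuous f ->
    \int[mu]_(t in A `|` B) f t
    = \int[mu]_(t in A) f t + \int[mu]_(t in B) f t.
  move=> cf; have intf : mu.-integrable (A `|` B) (EFin \o f).
    apply: continuous_compact_integrable; first exact: compactU.
    exact: continuous_subspaceT.
  by apply: Rintegral_setU => //; exact: compact_measurable.
by apply/andP; split; apply/eqP; apply: intU;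
  [exact: continuous_cosM|exact: continuous_sinM].
Qed.

Lemma fourier_indic_itv (xi a b : R) : xi != 0 -> a < b ->
  fourier (\1_(`[a, b])) xi
  = ((sin (2 * pi * xi * b) - sin (2 * pi * xi * a)) / (2 * pi * xi))
    +i* ((cos (2 * pi * xi * b) - cos (2 * pi * xi * a)) / (2 * pi * xi)).
Proof.
move=> xi0 ab.
have k0 : 2 * pi * xi != 0 by rewrite !mulf_neq0// gt_eqF// pi_gt0.
rewrite fourier_indic Rintegral_cosM ?Rintegral_sinM ?oppr_eq0//.
rewrite !mulNr !cosN !sinN invrN.
by congr (_ +i* _); ring.
Qed.

Lemma fourier_indic_itv_shift (xi a b : R) : xi != 0 -> a < b ->
  fourier (\1_(`[xi^-1 + a, xi^-1 + b])) xi = fourier (\1_(`[a, b])) xi.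
Proof.
move=> xi0 ab; rewrite !fourier_indic_itv ?ltrD2l//.
have E t : 2 * pi * xi * (xi^-1 + t) = 2 * pi * xi * t + pi *+ 2 by field.
by rewrite !E !sinD2pi !cosD2pi.
Qed.

(** With [c = pi xi l], the coefficient is
    [(sin (2 c) + i (cos (2 c) - 1)) / (2 pi xi)], that is
    [sin c (cos c - i sin c) / (pi xi)], where [cos c - i sin c] has modulus
    [1]. *)
Lemma norm_fourier_indic_itv (xi l : R) : 0 < xi -> 0 < l ->
  `| fourier (\1_(`[0, l])) xi | = (`|sin (pi * xi * l)| / (pi * xi))%:C.
Proof.
move=> xi0 l0; rewrite fourier_indic_itv ?gt_eqF// normc_def/=; congr (_%:C).
have k0 : 0 < pi * xi by rewrite mulr_gt0// pi_gt0.
rewrite mulr0 sin0 cos0 subr0.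
have -> : 2 * pi * xi * l = (pi * xi * l) *+ 2 by ring.
rewrite sin_mulr2n cos_mulr2n.
rewrite (_ : _ + _ = (sin (pi * xi * l) / (pi * xi)) ^+ 2).
  by rewrite sqrtr_sqr normrM normfV (gtr0_norm k0).
have := cos2sin2 (pi * xi * l).
move: (cos _) (sin _) => c s cs.
have -> : c ^+ 2 *+ 2 - 1 - 1 = - (s ^+ 2 *+ 2) by rewrite cs; ring.
rewrite -[c * s *+ 2]mulr_natl -[2 * pi * xi]mulrA !exprMn cs.
by move: (pi * xi) k0 => k k0; field; rewrite gt_eqF.
Qed.

Lemma fourier_indic_itv_sym (xi l : R) : xi != 0 -> 0 < l ->
  fourier (\1_(`[- l, l])) xi = (sin (2 * pi * xi * l) / (pi * xi))%:C.
Proof.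
move=> xi0 l0; rewrite fourier_indic_itv ?gtrN// mulrN cosN sinN subrr mul0r.
have k0 : pi * xi != 0 by rewrite mulf_neq0// gt_eqF// pi_gt0.
rewrite opprK -[2 * pi * xi]mulrA; congr (_ +i* _).
by move: (pi * xi) k0 => k k0; field.
Qed.

End fourier_indicator.

(** * The twin intervals *)

Section twin_intervals.
Variable R : realType.

Lemma sin2x_lt (c : R) : 0 < c < pi / 2 -> sin (c *+ 2) < 2 * sin c.
Proof.
move=> /sin_gt0_pihalf s0; rewrite sin_mulr2n.
have := cos2Dsin2 c; have := cos_le1 c.
move: (cos c) (sin c) s0 => x y y0 x1 xy1.
have x_lt1 : x < 1.
  by rewrite lt_neqAle x1 andbT; apply/eqP => xE; move: xy1; rewrite xE; nra.
by rewrite mulr_natl ltr_pMn2r// gtr_pMl.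
Qed.

Lemma disjoint_twin_itv (xi l : R) : l < 1 / xi ->
  [disjoint `[0%R, l] & `[1 / xi, 1 / xi + l]].
Proof.
move=> lxi; apply/disj_setPS => x [] /=; rewrite !in_itv/= => /andP[_ xl].
by move=> /andP[/le_lt_trans/(_ (le_lt_trans xl lxi))]; rewrite ltxx.
Qed.

Lemma lebesgue_measure_twin_itv (xi l : R) : 0 < l -> l < 1 / xi ->
  lebesgue_measure (twin_itv xi l) = (2 * l)%:E.
Proof.
move=> l0 lxi; rewrite /twin_itv measureU; last 3 first.
- exact: measurable_itv.
- exact: measurable_itv.
- exact/disj_set2P/disjoint_twin_itv.
rewrite [LHS]/= !lebesgue_measure_itv/= !lte_fin l0 ltrDl l0 -!EFinB -EFinD.
by congr (_%:E); ring.
Qed.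

Lemma ess_diam_twin_itv (xi l : R) : 0 < xi -> 0 < l ->
  ess_diam (measurable_twin_itv xi l) = (1 / xi + l)%:E.
Proof.
move=> xi0 l0; have xiV0 : 0 < 1 / xi by rewrite divr_gt0.
rewrite /ess_diam (@ess_sup_mrestr _ _ _ (1 / xi) (1 / xi + l)).
- rewrite (@ess_inf_mrestr _ _ _ 0 l) ?sube0//.
  + by move=> x xl; left; exact: subset_itv_oo_cc xl.
  + by move=> x [] /=; rewrite !in_itv/= andbT; lra.
- by rewrite ltrDl.
- by move=> x xl; right; exact: subset_itv_oo_cc xl.
- by move=> x [] /=; rewrite !in_itv/=; lra.
Qed.

End twin_intervals.

Theorem proposition4p1 (R : realType) (xi l : R)
    (xi_gt0 : 0 < xi) (l_gt0 : 0 < l) (l_lt : l < 1 / (2 * xi)) :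
  [/\ lebesgue_measure (twin_itv xi l) = (2 * l)%:E,
      ess_diam (measurable_twin_itv xi l) = (1 / xi + l)%:E,
      `| fourier (\1_(twin_itv xi l)) xi |
        = (2 * sin (pi * xi * l) / (pi * xi))%:C,
      2 * sin (pi * xi * l) / (pi * xi) > sin (2 * pi * xi * l) / (pi * xi) &
      (sin (2 * pi * xi * l) / (pi * xi))%:C = fourier (\1_(`[- l, l])) xi].
Proof.
have xi0 : xi != 0 by rewrite gt_eqF.
have pixi0 : 0 < pi * xi by rewrite mulr_gt0// pi_gt0.
have xil : xi * l < 1 / 2.
  by move: l_lt; rewrite ltr_pdivlMr ?mulr_gt0//; lra.
have l_period : l < 1 / xi by rewrite ltr_pdivlMr// mulrC; lra.
have c_itv : 0 < pi * xi * l < pi / 2.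
  by rewrite mulr_gt0//= -mulrA ltr_pM2l ?pi_gt0// -div1r.
split.
- exact: lebesgue_measure_twin_itv.
- exact: ess_diam_twin_itv.
- rewrite /twin_itv fourier_indicU; last 3 first.
  + exact: segment_compact.
  + exact: segment_compact.
  + exact: disjoint_twin_itv.
  have -> : fourier (\1_(`[1 / xi, 1 / xi + l])) xi
      = fourier (\1_(`[0%R, l])) xi.
    by rewrite -(@fourier_indic_itv_shift _ xi 0 l)// addr0 div1r.
  rewrite -mulr2n normrMn norm_fourier_indic_itv// -rmorphMn/=.
  by rewrite gtr0_norm ?sin_gt0_pihalf// mulr_natl mulrnAl.
- rewrite ltr_pM2r ?invr_gt0//.
  have -> : 2 * pi * xi * l = (pi * xi * l) *+ 2 by ring.
  exact: sin2x_lt.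
- by rewrite fourier_indic_itv_sym.
Qed.
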